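(* There exist positive numbers $\lambda_{ij}$, $i,j\in\mathbb{N}$, such that the space $\mathfrak{g}_\infty\subset HS$ generated by the orthonormal basis $\xi_{ij}=\lambda_{ij}e_{ij}$ is not a Lie algebra (that is, it is not closed under the commutator bracket $[x,y]=xy-yx$).
   Context: $H$ is a real separable infinite-dimensional Hilbert space; $HS$ is the space of Hilbert-Schmidt operators on $H$, viewed as infinite matrices $\{a_{ij}\}_{i,j=1}^\infty$ with $\sum_{i,j}|a_{ij}|^2<\infty$, with the Hilbert-Schmidt inner product $(\cdot,\cdot)_{HS}$; $e_{ij}$ is the matrix with $1$ at the $ij$th place and $0$ at all other places. For positive numbers $\lambda_{ij}$, $\mathfrak{g}_\infty$ is the (complete) space of all sums $\sum_{i,j} x_{ij}\xi_{ij}$ with $\sum_{i,j} x_{ij}^2<\infty$, with the inner product determined by $(\xi_{ij},\xi_{km})_{\mathfrak{g}_\infty}=(e_{ij},e_{km})_{HS}$. The standing assumption is that $\mathfrak{g}_\infty$ is a subspace of $HS$ and that it contains, as a subspace dense in the norm of $\mathfrak{g}_\infty$, a Lie algebra $\mathfrak{g}=\bigcup_n\mathfrak{g}_n$ that is an increasing union of finite-dimensional Lie algebras of operators in $HS$. *)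

(* Defs.v *)
From HB Require Import structures.
From mathcomp Require Import all_boot all_order all_algebra.
From mathcomp Require Import all_classical all_reals all_analysis.
Import Order.TTheory GRing.Theory Num.Theory.
Import numFieldNormedType.Exports.

Set Implicit Arguments.
Unset Strict Implicit.
Unset Printing Implicit Defensive.

Local Open Scope classical_set_scope.
Local Open Scope ring_scope.

(* Operators on a real separable infinite-dimensional Hilbert space are
   represented by their infinite matrices in a fixed orthonormal basis, indexed
   from 0.  [R^o] makes [infmx R] an [lmodType R] with entrywise operations. *)
Definition infmx (R : realType) : Type := nat -> nat -> R^o.
HB.instance Definition _ (R : realType) := GRing.Lmodule.on (infmx R).

Definition HS (R : realType) : set (infmx R) :=
  [set a | (\esum_(p in [set: nat * nat]) (`|a p.1 p.2| ^+ 2)%:E < +oo)%E].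

(* Limit of the square partial sums; on [HS] the double series converges
   absolutely, so the order of summation is irrelevant. *)
Definition HS_inner (R : realType) (a b : infmx R) : R :=
  limn (fun n => \sum_(i < n) \sum_(j < n) a i j * b i j : R).

(* Composition of operators; by Cauchy-Schwarz the series converge absolutely
   when [a] and [b] are in [HS]. *)
Definition infmx_mul (R : realType) (a b : infmx R) : infmx R :=
  fun i j => limn (series (fun k => a i k * b k j : R)).

Definition commutator (R : realType) (a b : infmx R) : infmx R :=
  infmx_mul a b - infmx_mul b a.

Definition unit_mx (R : realType) (i j : nat) : infmx R :=
  fun k m => ((k == i) && (m == j))%:R.

Definition xi (R : realType) (lam : nat -> nat -> R) (i j : nat) : infmx R :=
  lam i j *: unit_mx R i j.

(* The sums are taken entrywise, so that the definition does not presuppose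
   that they lie in [HS]. *)
Definition g_infty (R : realType) (lam : nat -> nat -> R) : set (infmx R) :=
  [set a | exists2 x : infmx R, HS x &
    forall k m : nat,
      (\sum_(i < n) \sum_(j < n) x i j *: xi lam i j : infmx R) k m
        @[n --> \oo] --> (a k m : R)].

(* Coefficients of [a] with respect to the family [xi lam]. *)
Definition coord (R : realType) (lam : nat -> nat -> R) (a : infmx R) :
  infmx R := fun i j => a i j / lam i j.

Definition g_inner (R : realType) (lam : nat -> nat -> R) (a b : infmx R) : R :=
  HS_inner (coord lam a) (coord lam b).

Definition g_norm (R : realType) (lam : nat -> nat -> R) (a : infmx R) : R :=
  Num.sqrt (g_inner lam a a).

Lemma coord_xi (R : realType) (lam : nat -> nat -> R)
    (lam_gt0 : forall i j, 0 < lam i j) (i j : nat) :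
  coord lam (xi lam i j) = unit_mx R i j.
Proof.
apply/funext => k; apply/funext => m.
rewrite /coord /xi /= /unit_mx.
have -> : (lam i j *: unit_mx R i j : infmx R) k m =
  lam i j * ((k == i) && (m == j))%:R by [].
case: eqP => [->|_]; last by rewrite mulr0 mul0r.
case: eqP => [->|_]; last by rewrite mulr0 mul0r.
by rewrite mulr1 divff // gt_eqF.
Qed.

(* The identity that determines the inner product of [g_infty]. *)
Lemma g_inner_xi (R : realType) (lam : nat -> nat -> R)
    (lam_gt0 : forall i j, 0 < lam i j) (i j k m : nat) :
  g_inner lam (xi lam i j) (xi lam k m) =
  HS_inner (unit_mx R i j) (unit_mx R k m).
Proof. by rewrite /g_inner !coord_xi. Qed.

Definition linear_subspace (R : realType) (S : set (infmx R)) : Prop :=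
  S 0 /\ forall (c : R) (a b : infmx R), S a -> S b -> S (c *: a + b).

Definition bracket_closed (R : realType) (S : set (infmx R)) : Prop :=
  forall a b : infmx R, S a -> S b -> S (commutator a b).

Definition finite_dimensional (R : realType) (S : set (infmx R)) : Prop :=
  exists (d : nat) (b : 'I_d -> infmx R),
    S = [set a | exists c : 'I_d -> R, a = \sum_(i < d) c i *: b i].

Definition HS_lie_algebra (R : realType) (S : set (infmx R)) : Prop :=
  [/\ S `<=` @HS R, linear_subspace S & bracket_closed S].

Definition dense_in_g_infty (R : realType) (lam : nat -> nat -> R)
    (S : set (infmx R)) : Prop :=
  S `<=` g_infty lam /\
  forall (a : infmx R) (e : R), g_infty lam a -> 0 < e ->
    exists2 b : infmx R, S b & g_norm lam (a - b) < e.

Definition standing_assumption (R : realType) (lam : nat -> nat -> R) : Prop :=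
  [/\ linear_subspace (g_infty lam), g_infty lam `<=` @HS R &
    exists g_ : nat -> set (infmx R),
      [/\ forall n, HS_lie_algebra (g_ n) /\ finite_dimensional (g_ n),
          forall n, g_ n `<=` g_ n.+1 &
          dense_in_g_infty lam (\bigcup_n g_ n)]].

(* Main.v *)
Require Import Defs.
From mathcomp Require Import all_boot all_order all_algebra.
From mathcomp Require Import all_classical all_reals all_analysis.
From mathcomp Require Import ring lra.
Import Order.TTheory GRing.Theory Num.Theory.
Import numFieldNormedType.Exports.

Set Implicit Arguments.
Unset Strict Implicit.
Unset Printing Implicit Defensive.

Local Open Scope classical_set_scope.
Local Open Scope ring_scope.

(** A matrix lies in the space with orthonormal basis [xi lam] exactly when
    its entries divided by the weights are square summable ([g_inftyP]).  A
    weight that decays along one row therefore makes membership a decay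
    condition on that row, and it suffices to let the bracket move a row
    without enough decay into this row.

    Take weight [2^-j] at place [(1, j)] and weight [1] at all other places.
    The matrix [y] whose row 0 is [2^-j] and whose other rows vanish has square
    summable coordinates, and so has the matrix unit [x] with its [1] at place
    [(1, 0)].  Left multiplication by [x] copies row 0 of [y] into row 1, while
    [yx] has zero row 1 because [y] does; so row 1 of [xy - yx] is [2^-j]
    ([commutator_geometric_row]).  Divided by the weights it is constantly [1],
    which is not square summable ([unit_row_not_HS]).

    The standing assumption holds for every weight with values in [(0, 1]]
    ([standing_assumption_le1]).  Dividing by such weights does not decrease
    absolute values, so the space lies in HS.  The matrices supported in the
    square of the first [n] rows and columns form a finite-dimensional Lie
    algebra; these algebras increase with [n], and their union is dense because
    the norm of the difference between a matrix and its [n]-th truncation is a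
    tail of a convergent series.

    All square summability questions are reduced to one monotone sequence, the
    sums of squares over growing squares of places ([HSP]). *)

(** * Square partial sums and the Hilbert-Schmidt condition *)

Definition sqsum (R : realType) (a : infmx R) (n : nat) : R :=
  \sum_(i < n) \sum_(j < n) (a i j : R) ^+ 2.

(** The increment from [sqsum a n] to [sqsum a n.+1]: the part of column [n]
    above row [n], and row [n] up to the diagonal. *)
Definition shell (R : realType) (a : infmx R) (n : nat) : R :=
  \sum_(i < n) (a i n : R) ^+ 2 + \sum_(j < n.+1) (a n j : R) ^+ 2.

Lemma sqsumS (R : realType) (a : infmx R) (n : nat) :
  sqsum a n.+1 = sqsum a n + shell a n.
Proof.
rewrite /sqsum /shell big_ord_recr /= addrA; congr (_ + _).
by rewrite -big_split; apply: eq_bigr => i _; rewrite big_ord_recr.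
Qed.

Lemma shell_ge0 (R : realType) (a : infmx R) (n : nat) : 0 <= shell a n.
Proof. by rewrite addr_ge0 // sumr_ge0 // => i _; rewrite sqr_ge0. Qed.

Lemma sqsum_nondecreasing (R : realType) (a : infmx R) :
  nondecreasing_seq (sqsum a).
Proof. by apply/nondecreasing_seqP => n; rewrite sqsumS lerDl shell_ge0. Qed.

Lemma esum_square (R : realType) (a : infmx R) (n : nat) :
  (\sum_(p \in `I_n `*` `I_n) (`|a p.1 p.2| ^+ 2)%:E)%E = (sqsum a n)%:E.
Proof.
rewrite -(@pair_fsbig _ _ _ _ _ _ _ (fun i j => (`|a i j| ^+ 2)%:E)) //=.
rewrite -(@fsbig_ord _ _ _ _ (fun i => \sum_(j \in `I_n) (`|a i j| ^+ 2)%:E)%E).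
rewrite /sqsum -sumEFin; apply: eq_bigr => i _.
rewrite -(@fsbig_ord _ _ _ _ (fun j => (`|a i j| ^+ 2)%:E)) -sumEFin.
by apply: eq_bigr => j _; rewrite real_normK // num_real.
Qed.

Lemma finite_sub_square {A : set (nat * nat)} : finite_set A ->
  exists n, A `<=` `I_n `*` `I_n.
Proof.
move=> /finite_fsetP[X ->].
exists (\max_(p <- finmap.enum_fset X) maxn p.1 p.2).+1 => p /= pX.
have := @leq_bigmax_seq _ _ predT (fun q => maxn q.1 q.2) p pX isT.
by rewrite geq_max => /andP[p1 p2]; split; rewrite ltnS.
Qed.

(** The unordered sum of nonnegative terms is the supremum over finite sets of
    places, and the squares are cofinal among these finite sets. *)
Lemma HSP (R : realType) (a : infmx R) :
  HS a <-> exists M : R, forall n, sqsum a n <= M.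
Proof.
have sq_ge0 (p : nat * nat) : (0 <= (`|a p.1 p.2| ^+ 2)%:E)%E.
  by rewrite lee_fin sqr_ge0.
split=> [aHS|[M aM]].
  exists (fine (\esum_(p in [set: nat * nat]) (`|a p.1 p.2| ^+ 2)%:E)%E) => n.
  rewrite -lee_fin fineK; last by rewrite ge0_fin_numE //; exact: esum_ge0.
  apply: esum_ge; exists (`I_n `*` `I_n); last by rewrite esum_square.
  by split=> //; exact: finite_setX.
apply: (@le_lt_trans _ _ M%:E); last exact: ltry.
apply: ge_ereal_sup => _ [A [Afin _] <-].
have [n An] := finite_sub_square Afin.
apply: (@le_trans _ _ (sqsum a n)%:E); last by rewrite lee_fin.
rewrite -esum_square; apply: lee_fsum_nneg_subset => //.
- exact: finite_setX.
- exact/subsetP.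
Qed.

Lemma cvg_sqsum {R : realType} {a : infmx R} : HS a -> cvgn (sqsum a).
Proof.
move=> /HSP[M aM]; apply: nondecreasing_is_cvgn.
  exact: sqsum_nondecreasing.
by exists M => _ [n _ <-].
Qed.

Lemma sqsum_le (R : realType) (a b : infmx R) (n : nat) :
  (forall i j, `|a i j| <= `|b i j|) -> sqsum a n <= sqsum b n.
Proof.
move=> ab; apply: ler_sum => i _; apply: ler_sum => j _.
by rewrite -[leLHS]real_normK ?num_real // -[leRHS]real_normK ?num_real //
  lerXn2r ?nnegrE.
Qed.

Lemma HS_le (R : realType) (a b : infmx R) :
  (forall i j, `|a i j| <= `|b i j|) -> HS b -> HS a.
Proof.
move=> ab /HSP[M bM]; apply/HSP; exists M => n.
exact: le_trans (sqsum_le n ab) (bM n).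
Qed.

(** Closure under linear combinations follows from
    [(c x + y)^2 <= 2 c^2 x^2 + 2 y^2]. *)
Lemma HS_linear_subspace (R : realType) : linear_subspace (@HS R).
Proof.
split=> [|c a b /HSP[M aM] /HSP[N bN]]; apply/HSP.
  exists 0 => n; rewrite /sqsum big1 // => i _; rewrite big1 // => j _.
  exact: expr0n.
exists (2 * c ^+ 2 * M + 2 * N) => n.
apply: (@le_trans _ _ (2 * c ^+ 2 * sqsum a n + 2 * sqsum b n)); last first.
  by rewrite lerD // ler_wpM2l // mulr_ge0 // sqr_ge0.
rewrite /sqsum !mulr_sumr -big_split; apply: ler_sum => i _ /=.
rewrite !mulr_sumr -big_split; apply: ler_sum => j _ /=.
have -> : (c *: a + b) i j = c * (a i j : R) + (b i j : R) by [].
(* The gap in this bound is the square [(c x - y)^2]. *)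
have := sqr_ge0 (c * (a i j : R) - (b i j : R)).
nra.
Qed.

(** * Matrices supported in a finite square *)

Definition square_support (R : realType) (n : nat) : set (infmx R) :=
  [set a | forall k m, (n <= maxn k m)%N -> a k m = 0].

Definition truncation (R : realType) (n : nat) (a : infmx R) : infmx R :=
  fun k m => if (maxn k m < n)%N then a k m else 0.

Lemma truncation_support (R : realType) (n : nat) (a : infmx R) :
  square_support n (truncation n a).
Proof. by move=> k m; rewrite leqNgt /truncation => /negbTE ->. Qed.

Lemma truncation_id (R : realType) (n : nat) (a : infmx R) :
  square_support n a -> truncation n a = a.
Proof.
move=> an; apply/funext => k; apply/funext => m; rewrite /truncation.
by case: ltnP => // /an ->.
Qed.

Lemma sum_infmxE (R : realType) (I : finType) (f : I -> infmx R) (k m : nat) :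
  (\sum_i f i) k m = \sum_i (f i k m : R).
Proof. by elim/big_rec2: _ => // i x y _ <-. Qed.

Lemma sum_unit_mx (R : realType) (n : nat) (c : infmx R) :
  \sum_(i < n) \sum_(j < n) (c i j : R) *: unit_mx R i j = truncation n c.
Proof.
apply/funext => k; apply/funext => m.
have entry i j : ((c i j : R) *: unit_mx R i j) k m =
  (c i j : R) * ((k == i) && (m == j))%:R by [].
rewrite sum_infmxE /truncation gtn_max.
under eq_bigr => i _ do rewrite sum_infmxE.
have [kn|nk] := ltnP k n; last first.
  rewrite big1 // => i _; rewrite big1 // => j _.
  by rewrite entry gtn_eqF ?mulr0 // (leq_trans (ltn_ord i)).
have [mn|nm] := ltnP m n; last first.
  rewrite big1 // => i _; rewrite big1 // => j _.
  by rewrite entry andbC gtn_eqF ?mulr0 // (leq_trans (ltn_ord j)).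
rewrite (bigD1 (Ordinal kn)) //= [X in _ + X]big1 => [|i ik]; last first.
  rewrite big1 // => j _.
  by rewrite entry (_ : (k == i) = false) ?mulr0 // eq_sym; exact/negbTE.
rewrite (bigD1 (Ordinal mn)) //= [X in _ + X + _]big1 => [|j jm]; last first.
  rewrite entry (_ : (m == j) = false) ?andbF ?mulr0 // eq_sym.
  exact/negbTE.
by rewrite entry !eqxx mulr1 !addr0.
Qed.

(** Subtracting from [a] its own [N]-corner kills the first [N] shells and
    leaves the others unchanged, so the sums of squares of the remainder are
    tails of those of [a]. *)
Lemma sqsum_supportD (R : realType) (N : nat) (a b : infmx R) :
  square_support N b ->
  (forall k m, (maxn k m < N)%N -> a k m = b k m) ->
  forall n, sqsum (a - b) (N + n)%N = sqsum a (N + n)%N - sqsum a N.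
Proof.
move=> bN ab; elim=> [|n IHn].
  rewrite addn0 subrr /sqsum big1 // => i _; rewrite big1 // => j _.
  have -> : (a - b) i j = (a i j : R) - (b i j : R) by [].
  by rewrite ab ?gtn_max ?ltn_ord // subrr expr0n.
rewrite addnS !sqsumS IHn addrAC; congr (_ + _ - _).
have abE i j : (N <= maxn i j)%N -> (a - b) i j = a i j.
  move=> Nij; have -> : (a - b) i j = (a i j : R) - (b i j : R) by [].
  by rewrite bN // subr0.
rewrite /shell; congr (_ + _); apply: eq_bigr => i _; rewrite abE //.
  by rewrite leq_max leq_addr orbT.
by rewrite leq_max leq_addr.
Qed.

(** The remainder of [a] over its corner is [0] here, so [sqsum_supportD] says
    that the sums of squares of [a] are constant from [n] on. *)
Lemma HS_support {R : realType} {n : nat} {a : infmx R} :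
  square_support n a -> HS a.
Proof.
move=> an; apply/HSP; exists (sqsum a n) => k.
have := sqsum_supportD an (fun _ _ _ => erefl) k.
rewrite subrr => /esym/eqP.
have -> : sqsum (0 : infmx R) (n + k)%N = 0 :> R.
  rewrite /sqsum big1 // => i _; rewrite big1 // => j _; exact: expr0n.
rewrite subr_eq0 => /eqP <-.
exact: sqsum_nondecreasing (leq_addl _ _).
Qed.

(** The defining series has zero partial sums, so its limit is [0] even when
    [a] and [b] are not square summable. *)
Lemma infmx_mul_eq0 (R : realType) (a b : infmx R) (i j : nat) :
  (forall k, (a i k : R) * (b k j : R) = 0) -> infmx_mul a b i j = 0.
Proof.
move=> ab0; rewrite /infmx_mul.
rewrite (_ : series _ = fun=> 0) ?lim_cst //.
by apply/funext => n; rewrite /series /= big1.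
Qed.

(** In a place outside the square either the row of [a] or the column of [b]
    vanishes identically. *)
Lemma square_support_mul (R : realType) (n : nat) (a b : infmx R) :
  square_support n a -> square_support n b ->
  square_support n (infmx_mul a b).
Proof.
move=> an bn k m; rewrite leq_max => /orP[nk|nm]; apply: infmx_mul_eq0 => l.
  by rewrite an ?mul0r // leq_max nk.
by rewrite bn ?mulr0 // leq_max nm orbT.
Qed.

Lemma square_support_linear (R : realType) (n : nat) :
  linear_subspace (@square_support R n).
Proof.
split=> // c a b an bn k m nkm.
have -> : (c *: a + b) k m = c * (a k m : R) + (b k m : R) by [].
by rewrite an // bn // mulr0 addr0.
Qed.

Lemma square_support_lie_algebra (R : realType) (n : nat) :
  HS_lie_algebra (@square_support R n).
Proof.
have [supp0 suppD] := square_support_linear R n.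
split=> [a|//|a b an bn]; first exact: HS_support.
have -> : commutator a b = (-1 : R) *: infmx_mul b a + infmx_mul a b.
  by rewrite scaleN1r addrC.
by apply: suppD; exact: square_support_mul.
Qed.

Lemma square_support_finite_dimensional (R : realType) (n : nat) :
  finite_dimensional (@square_support R n).
Proof.
pose b (p : 'I_n * 'I_n) := unit_mx R p.1 p.2.
exists #|{: 'I_n * 'I_n}|, (fun i => b (enum_val i)).
have sumE (f : nat -> nat -> R) :
    \sum_(i < #|{: 'I_n * 'I_n}|)
      f (enum_val i).1 (enum_val i).2 *: b (enum_val i) = truncation n f.
  rewrite -sum_unit_mx pair_big /=.
  by rewrite -(big_enum_val (fun p : 'I_n * 'I_n => f p.1 p.2 *: b p)).
apply/seteqP; split=> [a an|_ [c ->]].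
  exists (fun i : 'I_#|{: 'I_n * 'I_n}| => a (enum_val i).1 (enum_val i).2).
  by rewrite sumE truncation_id.
move=> k m nkm; rewrite sum_infmxE big1 // => i _.
have -> : (c i *: b (enum_val i)) k m = c i *
  ((k == (enum_val i).1) && (m == (enum_val i).2))%:R by [].
move: nkm; rewrite leq_max => /orP[nk|nm].
  by rewrite gtn_eqF ?mulr0 // (leq_trans (ltn_ord _)).
by rewrite andbC gtn_eqF ?mulr0 // (leq_trans (ltn_ord _)).
Qed.

(** * The space with orthonormal basis [xi lam] *)

(** Each entry of the partial sums is eventually constant, equal to a
    coefficient times its weight; hence the coefficients of [a] can only be its
    entries divided by the weights. *)
Lemma g_inftyP (R : realType) (lam : nat -> nat -> R) (a : infmx R) :
  (forall i j, 0 < lam i j) -> g_infty lam a <-> HS (Defs.coord lam a).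
Proof.
move=> lam_gt0.
have partial (x : infmx R) (k m n : nat) : (maxn k m < n)%N ->
    (\sum_(i < n) \sum_(j < n) (x i j : R) *: xi lam i j) k m =
    (x k m : R) * lam k m.
  move=> kmn; pose c : infmx R := fun i j => (x i j : R) * lam i j.
  transitivity (truncation n c k m); last by rewrite /truncation kmn.
  rewrite -sum_unit_mx; congr (_ k m); apply: eq_bigr => i _.
  by apply: eq_bigr => j _; rewrite /xi scalerA.
have partial_cvg (x : infmx R) (k m : nat) :
    (\sum_(i < n) \sum_(j < n) (x i j : R) *: xi lam i j) k m
      @[n --> \oo] --> ((x k m : R) * lam k m : R).
  apply: cvg_near_cst; exists (maxn k m).+1 => // n /= kmn.
  exact: partial.
split=> [[x xHS xa]|aHS].
  suff -> : Defs.coord lam a = x by [].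
  apply/funext => k; apply/funext => m; rewrite /Defs.coord.
  have -> : (a k m : R) = (x k m : R) * lam k m.
    exact: cvg_unique (xa k m) (partial_cvg x k m).
  by rewrite mulfK // gt_eqF.
exists (Defs.coord lam a) => // k m.
have -> : (a k m : R) = (Defs.coord lam a k m : R) * lam k m.
  by rewrite /Defs.coord divfK // gt_eqF.
exact: partial_cvg.
Qed.

Lemma coordD (R : realType) (lam : nat -> nat -> R) (c : R) (a b : infmx R) :
  Defs.coord lam (c *: a + b) = c *: Defs.coord lam a + Defs.coord lam b.
Proof.
apply/funext => i; apply/funext => j.
have -> : (c *: Defs.coord lam a + Defs.coord lam b) i j =
  c * ((a i j : R) / lam i j) + (b i j : R) / lam i j by [].
by rewrite mulrA -mulrDl.
Qed.

Lemma coord_support (R : realType) (lam : nat -> nat -> R) (n : nat)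
    (a : infmx R) :
  square_support n a -> square_support n (Defs.coord lam a).
Proof. by move=> an k m nkm; rewrite /Defs.coord an // mul0r. Qed.

Lemma HS_inner_diag (R : realType) (a : infmx R) :
  HS_inner a a = limn (sqsum a).
Proof. by []. Qed.

(** The squared norm of the remainder is the tail
    [limn (sqsum a) - sqsum a N]. *)
Lemma truncation_approx (R : realType) (a : infmx R) (e : R) :
  HS a -> 0 < e ->
  exists N, HS_inner (a - truncation N a) (a - truncation N a) < e.
Proof.
move=> aHS e0; have acvg := cvg_sqsum aHS.
(* [lt_lim] yields a non-strict bound, so half of [e] is kept in reserve. *)
have : limn (sqsum a) - e / 2 < limn (sqsum a) by lra.
move=> /(lt_lim (@sqsum_nondecreasing R a) acvg)[N _ /(_ N (leqnn N)) /= aN].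
exists N; set b := a - _.
have -> : HS_inner b b = limn (sqsum a) - sqsum a N.
  rewrite HS_inner_diag; apply: cvg_lim => //; rewrite -(cvg_shiftn N).
  have -> : [sequence sqsum b (n + N)%N]_n =
      (fun n => sqsum a (n + N)%N - sqsum a N).
    apply/funext => n /=; rewrite addnC.
    apply: sqsum_supportD (@truncation_support R N a) _ n => k m kmN.
    by rewrite /truncation kmN.
  by apply: cvgB; [rewrite (cvg_shiftn N)|exact: cvg_cst].
lra.
Qed.

(** Taking coordinates is linear and commutes with truncation, so this is
    [truncation_approx] read in coordinates; the norm being a square root, the
    tail has to be below [e ^+ 2]. *)
Lemma truncation_dense (R : realType) (lam : nat -> nat -> R) :
  (forall i j, 0 < lam i j) ->
  dense_in_g_infty lam (\bigcup_n @square_support R n).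
Proof.
move=> lam_gt0; split=> [a [n _ an]|a e /(g_inftyP a lam_gt0) aHS e0].
  apply/g_inftyP => //; exact: HS_support (coord_support lam an).
have e20 : 0 < e ^+ 2 by rewrite exprn_gt0.
have [N aN] := truncation_approx aHS e20.
exists (truncation N a); first by exists N => //; exact: truncation_support.
rewrite -[ltRHS]gtr0_norm // -sqrtr_sqr ltr_sqrt //.
suff -> : g_inner lam (a - truncation N a) (a - truncation N a) =
  HS_inner (Defs.coord lam a - truncation N (Defs.coord lam a))
           (Defs.coord lam a - truncation N (Defs.coord lam a)) by [].
suff : Defs.coord lam (a - truncation N a) =
  Defs.coord lam a - truncation N (Defs.coord lam a).
  by rewrite /g_inner => ->.
rewrite addrC -scaleN1r coordD scaleN1r addrC; congr (_ - _).
apply/funext => i; apply/funext => j; rewrite /Defs.coord /truncation.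
by case: ifP => // _; rewrite mul0r.
Qed.

Lemma standing_assumption_le1 (R : realType) (lam : nat -> nat -> R) :
  (forall i j, 0 < lam i j) -> (forall i j, lam i j <= 1) ->
  standing_assumption lam.
Proof.
move=> lam_gt0 lam_le1; have [HS0 HSD] := HS_linear_subspace R.
split.
- split=> [|c a b /(g_inftyP a lam_gt0) aHS
                  /(g_inftyP b lam_gt0) bHS]; apply/g_inftyP => //.
    by apply: (@HS_support _ 0); apply: coord_support.
  by rewrite coordD; exact: HSD.
- move=> a /(g_inftyP a lam_gt0); apply: HS_le => i j.
  rewrite /Defs.coord normrM ler_peMr // gtr0_norm ?invr_gt0 ?lam_gt0 //.
  by rewrite invf_gte1 ?lam_gt0 ?lam_le1.
exists (@square_support R); split=> [n|n a an k m nkm|].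
- split; first exact: square_support_lie_algebra.
  exact: square_support_finite_dimensional.
- exact: an (ltnW nkm).
- exact: truncation_dense.
Qed.

(** * A weight whose space is not closed under the bracket *)

Definition thin_row_weight (R : realType) (i j : nat) : R :=
  if i == 1%N then 2^-1 ^+ j else 1.

Lemma thin_row_weight_gt0 (R : realType) (i j : nat) :
  0 < thin_row_weight R i j.
Proof. by rewrite /thin_row_weight; case: ifP => // _; rewrite exprn_gt0. Qed.

Lemma thin_row_weight_le1 (R : realType) (i j : nat) :
  thin_row_weight R i j <= 1.
Proof.
rewrite /thin_row_weight; case: ifP => // _; apply: exprn_ile1 => //.
by rewrite invf_cp1 // ler1n.
Qed.

Definition geometric_row (R : realType) : infmx R :=
  fun i j => if i == 0%N then 2^-1 ^+ j else 0.

(** The squares form the geometric series of ratio [1/4].  The induction needs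
    the stronger bound [2 (1 - 4^-k)], since the constant bound [2] is not
    inductive; the value [4/3] of the series leaves room. *)
Lemma geometric_row_HS (R : realType) : HS (geometric_row R).
Proof.
apply/HSP; exists 2 => -[|n]; first by rewrite /sqsum big_ord0.
rewrite /sqsum big_ord_recl [X in _ + X]big1 ?addr0; last first.
  by move=> i _; rewrite big1 // => j _; rewrite /geometric_row /= expr0n.
suff H k : \sum_(j < k) (geometric_row R 0 j : R) ^+ 2 <= 2 * (1 - 4^-1 ^+ k).
  apply: le_trans (H n.+1) _.
  by rewrite ler_piMr // gerBl exprn_ge0.
elim: k => [|k IHk]; first by rewrite big_ord0 expr0 subrr mulr0.
rewrite big_ord_recr /= /geometric_row /= exprAC.
have -> : (2^-1 : R) ^+ 2 = 4^-1 by rewrite expr2; field.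
have := exprn_ge0 k (_ : 0 <= 4^-1 :> R); rewrite exprS.
move: IHk; rewrite /geometric_row /=; set s := \sum_(_ < _) _.
move=> sk /(_ ltac:(by [])); lra.
Qed.

(** The series for an entry of row 1 can have a nonzero term only at
    index 0. *)
Lemma unit_mx10_mul (R : realType) (a : infmx R) (j : nat) :
  infmx_mul (unit_mx R 1 0) a 1 j = a 0%N j.
Proof.
apply: cvg_lim => //; apply: cvg_near_cst; exists 1%N => // -[//|n] _ /=.
rewrite /series /= big_nat_recl //= big1_seq ?addr0.
  by rewrite /unit_mx /= mul1r.
by move=> i _; rewrite /unit_mx /= mul0r.
Qed.

(** Only the first product contributes to row 1, as row 1 of the geometric row
    matrix is zero. *)
Lemma commutator_geometric_row (R : realType) (j : nat) :
  commutator (unit_mx R 1 0) (geometric_row R) 1 j = 2^-1 ^+ j.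
Proof.
have -> : commutator (unit_mx R 1 0) (geometric_row R) 1 j =
  (infmx_mul (unit_mx R 1 0) (geometric_row R) 1 j : R)
  - (infmx_mul (geometric_row R) (unit_mx R 1 0) 1 j : R) by [].
rewrite unit_mx10_mul infmx_mul_eq0 ?subr0 // => k.
by rewrite /geometric_row /= mul0r.
Qed.

Lemma unit_row_not_HS (R : realType) (a : infmx R) (i : nat) :
  (forall j, a i j = 1) -> ~ HS a.
Proof.
move=> ai /HSP[M aM].
have [n Mn] : exists n : nat, M < n%:R.
  exists (Num.truncn `|M|).+1.
  by apply: le_lt_trans (ler_norm M) _; rewrite truncnS_gt.
(* The square of this size contains row [i] and at least [n] of its places. *)
have := aM (i.+1 + n)%N; apply/negP; rewrite -ltNge.
apply: lt_le_trans Mn _.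
have iN : (i < i.+1 + n)%N by rewrite leq_addr.
rewrite /sqsum (bigD1 (Ordinal iN)) //=.
under eq_bigr => j _ do rewrite ai expr1n.
rewrite sumr_const card_ord -[leLHS]addr0 lerD ?ler_nat ?leq_addl //.
by apply: sumr_ge0 => k _; apply: sumr_ge0 => j _; rewrite sqr_ge0.
Qed.

Theorem proposition4p3 (R : realType) :
  exists lam : nat -> nat -> R,
    [/\ forall i j : nat, 0 < lam i j,
        standing_assumption lam &
        ~ bracket_closed (g_infty lam)].
Proof.
have lam_gt0 := thin_row_weight_gt0 R.
exists (thin_row_weight R); split=> //.
  exact: standing_assumption_le1 lam_gt0 (thin_row_weight_le1 R).
move=> closed.
have unit_in : g_infty (thin_row_weight R) (unit_mx R 1 0).
  (* The only nonzero entry, at place [(1, 0)], lies in the square of size 2. *)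
  apply/g_inftyP => //; apply: (@HS_support _ 2); apply: coord_support => k m.
  by rewrite /unit_mx; case: k m => [|[|k]] [|m].
have row_in : g_infty (thin_row_weight R) (geometric_row R).
  apply/g_inftyP => //; apply: HS_le (geometric_row_HS R) => i j.
  rewrite /Defs.coord /geometric_row /thin_row_weight.
  by case: i => [|i]; rewrite ?divr1 // mul0r.
have /(g_inftyP _ lam_gt0) := closed _ _ unit_in row_in.
apply: (@unit_row_not_HS _ _ 1) => j.
by rewrite /Defs.coord commutator_geometric_row /thin_row_weight /= divff //.
Qed.
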